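(* Let $k\in\mathbb N$ ($k\ge 0$), and suppose that the Tracking Assumption (see context) holds up to iteration $k$, i.e., on every iteration $n=0,\ldots,k$, with constants independent of $n$, and that $\{x^n\}_{n=0}^k\subset\Omega_X$. Let $\kappa:=\min(\kappa_u,\kappa_w)$ and $\overline\kappa:=\max(\kappa_u,\kappa_w)$. Then there exist a constant $\varsigma_1\ge0$ with \[ \varsigma_1\le\frac{(\alpha_u\pi_u+\alpha_w\pi_w)\kappa\overline\kappa}{\kappa-1}+\frac{\alpha_w\mu_u\pi_u\overline\kappa}{(\kappa-1)^2} \] and numbers $e_{\mathrm{lip},0},\ldots,e_{\mathrm{lip},k}\ge0$ such that for all $n=0,\ldots,k$, \[ \|\tilde F'_n-F'(x^n)\|_*^2\le\bigl(\alpha_u d_U(u^{n+1},S_u(x^n))+\alpha_w d_W(w^{n+1},S_w(x^n))\bigr)^2\le e_{\mathrm{lip},n}, \] and \[ \sum_{n=0}^{k-1}e_{\mathrm{lip},n}\le\Psi_1+\varsigma_1^2\sum_{n=0}^{k-1}\|x^{n+1}-x^n\|_\circ^2, \] where \[ \Psi_1:=\frac{d_U^2(u^1,S_u(x^0))}{\pi_u}\left(\frac{\varsigma_1\alpha_u\kappa}{\kappa-1}+\frac{\varsigma_1\alpha_w\mu_u}{(\kappa-1)^2}\right)+\frac{d_W^2(w^1,S_w(x^0))}{\pi_w}\left(\frac{\varsigma_1\alpha_w\kappa}{\kappa-1}\right). \]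
   Context: All normed spaces are real; $\langle x^*|x\rangle$ is the dual pairing between $X^*$ and $X$. $X$ and $U$ are normed spaces, $J:U\to\mathbb R$ and $S_u:X\to U$ are Fréchet differentiable, and $F:=J\circ S_u$. The space $X$ is equipped with a semi-norm $\|\cdot\|_\circ$, and $X^*$ with $\|x^*\|_*:=\sup\{\langle x^*|x\rangle: x\in X,\ \|x\|_\circ\le1\}\in[0,\infty]$. The spaces $U$ and $W$ are equipped with distance functions $d_U:U\times U\to[0,\infty]$, $d_W:W\times W\to[0,\infty]$; $d_U^2(u,\tilde u):=d_U(u,\tilde u)^2$, and likewise for $d_W$. $S_u$ is called the inner solution map and $S_w:X\to W$ the adjoint solution map. $\Omega_X\subset X$ is a given subset. There are sequences $x^n\in X$ (produced by an arbitrary outer algorithm), $u^n\in U$, $w^n\in W$, and differential estimates $\tilde F'_n\in X^*$ of $F'(x^n)$. Tracking Assumption on iteration $n\ge0$: given $\{(x^j,u^j,w^j)\}_{j=0}^n\subset\Omega_X\times U\times W$, the elements $u^{n+1}\in U$, $w^{n+1}\in W$ and $\tilde F'_n\in X^*$ satisfy, for constants $\pi_u,\pi_w,\mu_u>0$, $\kappa_u,\kappa_w>1$, $\alpha_u,\alpha_w\ge0$: (i) if $n\ge1$: $\kappa_u d_U(u^{n+1},S_u(x^n))\le d_U(u^n,S_u(x^{n-1}))+\pi_u\|x^n-x^{n-1}\|_\circ$; (ii) if $n\ge1$: $\kappa_w d_W(w^{n+1},S_w(x^n))\le d_W(w^n,S_w(x^{n-1}))+\mu_u d_U(u^{n+1},S_u(x^n))+\pi_w\|x^n-x^{n-1}\|_\circ$;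 (iii) $\|\tilde F'_n-F'(x^n)\|_*\le\alpha_u d_U(u^{n+1},S_u(x^n))+\alpha_w d_W(w^{n+1},S_w(x^n))$. *)

(* Defs.v *)
From HB Require Import structures.
From mathcomp Require Import all_boot all_order all_algebra.
From mathcomp Require Import all_classical all_reals all_analysis.

Set Implicit Arguments.
Unset Strict Implicit.
Unset Printing Implicit Defensive.

Import Order.TTheory GRing.Theory Num.Theory.
Import numFieldNormedType.Exports.

Local Open Scope classical_set_scope.
Local Open Scope ring_scope.

Record is_seminorm (R : realType) (X : normedModType R) (p : X -> R) : Prop :=
  IsSeminorm {
    seminorm_ge0 : forall x, 0 <= p x ;
    seminormZ : forall (a : R) x, p (a *: x) = `|a| * p x ;
    seminorm_triangle : forall x y, p (x + y) <= p x + p y }.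

(* No continuity of [p] is assumed, so the value may be +oo; it is never
   negative because [x = 0] is admissible. *)
Definition dual_norm (R : realType) (X : normedModType R) (p : X -> R)
    (f : X -> R) : \bar R :=
  ereal_sup [set (f x)%:E | x in [set x | p x <= 1]].

Local Open Scope ereal_scope.

(* [dU], [dW] take values in [0, +oo]. Products of extended reals follow the
   library convention 0 * +oo = 0, so a term with a zero coefficient vanishes
   even if the distance is infinite. *)
Definition tracking_error (R : realType) (X U W : Type)
    (dU : U -> U -> \bar R) (dW : W -> W -> \bar R)
    (Su : X -> U) (Sw : X -> W) (alpha_u alpha_w : R)
    (x : nat -> X) (u : nat -> U) (w : nat -> W) (n : nat) : \bar R :=
  alpha_u%:E * dU (u n.+1) (Su (x n)) + alpha_w%:E * dW (w n.+1) (Sw (x n)).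

Record tracking_bounds (R : realType) (X U : normedModType R) (W : Type)
    (p : X -> R) (dU : U -> U -> \bar R) (dW : W -> W -> \bar R)
    (J : U -> R^o) (Su : X -> U) (Sw : X -> W)
    (pi_u pi_w mu_u kappa_u kappa_w alpha_u alpha_w : R)
    (x : nat -> X) (u : nat -> U) (w : nat -> W)
    (Ft : nat -> {linear X -> R^o}) (n : nat) : Prop := TrackingBounds {
  tracking_inner : (1 <= n)%N ->
    kappa_u%:E * dU (u n.+1) (Su (x n)) <=
      dU (u n) (Su (x n.-1)) + (pi_u * p (x n - x n.-1)%R)%:E ;
  tracking_adjoint : (1 <= n)%N ->
    kappa_w%:E * dW (w n.+1) (Sw (x n)) <=
      dW (w n) (Sw (x n.-1)) + mu_u%:E * dU (u n.+1) (Su (x n))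
      + (pi_w * p (x n - x n.-1)%R)%:E ;
  tracking_differential :
    dual_norm p (Ft n \- 'd (J \o Su) (x n))%R <=
      tracking_error dU dW Su Sw alpha_u alpha_w x u w n }.

Definition tracking_assumption (R : realType) (X U : normedModType R)
    (W : Type) (OmegaX : set X)
    (p : X -> R) (dU : U -> U -> \bar R) (dW : W -> W -> \bar R)
    (J : U -> R^o) (Su : X -> U) (Sw : X -> W)
    (pi_u pi_w mu_u kappa_u kappa_w alpha_u alpha_w : R)
    (x : nat -> X) (u : nat -> U) (w : nat -> W)
    (Ft : nat -> {linear X -> R^o}) (n : nat) : Prop :=
  (forall j, (j <= n)%N -> OmegaX (x j)) ->
  tracking_bounds p dU dW J Su Sw
    pi_u pi_w mu_u kappa_u kappa_w alpha_u alpha_w x u w Ft n.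

Definition Psi1 (R : realType)
    (pi_u pi_w mu_u alpha_u alpha_w kappa sigma1 : R) (dU1 dW1 : \bar R)
    : \bar R :=
  dU1 ^+ 2 * (pi_u^-1)%:E *
    (sigma1 * alpha_u * kappa / (kappa - 1)
     + sigma1 * alpha_w * mu_u / (kappa - 1) ^+ 2)%:E
  + dW1 ^+ 2 * (pi_w^-1)%:E *
    (sigma1 * alpha_w * kappa / (kappa - 1))%:E.

(* Main.v *)
Require Import Defs.
From HB Require Import structures.
From mathcomp Require Import all_boot all_order all_algebra.
From mathcomp Require Import all_classical all_reals all_analysis.
From mathcomp Require Import ring lra.

Set Implicit Arguments.
Unset Strict Implicit.

Import Order.TTheory GRing.Theory Num.Theory.
Import numFieldNormedType.Exports.

Local Open Scope classical_set_scope.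
Local Open Scope ring_scope.

(** The bound [e_lip, n] is the squared error estimate [E n ^ 2] itself, with
[E n = alpha_u * a n + alpha_w * b n], where [a n] and [b n] are the distances
of the inner and adjoint iterates [u (n+1)], [w (n+1)] from the exact solutions
at [x n]. Only the summed estimate then requires work.

Both tracking inequalities, with [kappa_u] and [kappa_w] lowered to their
minimum [kappa], say that a distance is contracted by [kappa] after being
enlarged by an input: the step length [s n] in the case of [a], and a
combination of [s n] and [a (n+1)] in the case of [b]. Unrolled, each [E n] is
a positive combination of [a 0], [b 0] and past steps, and Jensen's inequality
bounds [E n ^ 2] by the total weight times the same combination of squares.
Unrolling can be avoided: the estimate [a n ^ 2 <= M * Q n] propagates along the
recursion whenever [Q] obeys the recursion with squared input and [M] is a
supersolution of the corresponding recursion for the total weight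
([sqr_le_mass_leaky_sum], by [sqr_add_le_mass_moment]). The supersolutions for
[a] and [b] combine to the constant [tracking_rate], which is the choice of
[sigma1]. The sums of the [Q n] are controlled by telescoping
([sum_leaky_sum_succ_le], [sum_leaky_sum_le]), and
[sum_sqr_real_tracking_error_le] collects the constants.

Infinite distances are handled in [sum_sqr_tracking_error_le]. The first
distances are the only possible source of infinity, since the tracking
inequalities propagate finiteness. If an infinite first distance has a positive
coefficient in [Psi1], then the right-hand side is [+oo]. The coefficient of
[a 0] vanishes only if [alpha_u = alpha_w = 0], when all [E n] are zero;
otherwise that of [b 0] vanishes only if [alpha_w = 0], when [E n] does not
depend on [b] and [b] can be replaced by [0]. *)

(** * Recursions with contraction and input *)

(** Jensen's inequality for the square with weights [M] and [N], in a form
that composes: each of [y], [z] may itself be a combination already bounded by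
its mass times its second moment. *)
Lemma sqr_add_le_mass_moment (R : realFieldType) (y z M N q r : R) :
  0 <= M -> 0 <= N -> 0 <= q -> 0 <= r ->
  y ^+ 2 <= M * q -> z ^+ 2 <= N * r ->
  (y + z) ^+ 2 <= (M + N) * (q + r).
Proof.
move=> M0 N0 q0 r0 yle zle.
(* The cross term is bounded by [M * r + N * q], since
   [4 * y^2 * z^2 <= 4 * (M * r) * (N * q) <= (M * r + N * q)^2]. *)
have yz : (2 * (y * z)) ^+ 2 <= (M * r + N * q) ^+ 2.
  have := ler_pM (sqr_ge0 y) (sqr_ge0 z) yle zle.
  have := sqr_ge0 (M * r - N * q).
  rewrite !expr2; nra.
have : 2 * (y * z) <= M * r + N * q.
  apply: (le_trans (ler_norm _)); rewrite -ler_sqr ?nnegrE ?normr_ge0 //.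
    by rewrite real_normK // num_real.
  by apply: addr_ge0 => //; apply: mulr_ge0.
rewrite !expr2 in yle zle *; nra.
Qed.

Fixpoint leaky_sum {R : realFieldType} (kappa q0 : R) (r : nat -> R) (n : nat)
    : R :=
  if n is m.+1 then (leaky_sum kappa q0 r m + r m) / kappa else q0.

Lemma leaky_sum_ge0 (R : realFieldType) (kappa q0 : R) (r : nat -> R) n :
  0 < kappa -> 0 <= q0 -> (forall m, 0 <= r m) ->
  0 <= leaky_sum kappa q0 r n.
Proof.
move=> k0 q00 r0; elim: n => //= n IH.
by rewrite divr_ge0 ?addr_ge0 // ltW.
Qed.

(** Summing [kappa * Q (n+1) = Q n + r n] and telescoping leaves
[(kappa - 1) * sum Q (n+1) = q0 + sum r - Q k]. *)
Lemma sum_leaky_sum_succ_le (R : realFieldType) (kappa q0 : R) (r : nat -> R) k :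
  1 < kappa -> 0 <= q0 -> (forall m, 0 <= r m) ->
  \sum_(n < k) leaky_sum kappa q0 r n.+1
    <= (q0 + \sum_(n < k) r n) / (kappa - 1).
Proof.
move=> k1 q00 r0; rewrite ler_pdivlMr ?subr_gt0 //.
have kn0 : kappa != 0 by rewrite gt_eqF // (lt_trans ltr01).
have tele : \sum_(n < k) leaky_sum kappa q0 r n.+1 * (kappa - 1)
    = q0 + \sum_(n < k) r n - leaky_sum kappa q0 r k.
  elim: k => [|k IH]; first by rewrite !big_ord0 /= addr0 subrr.
  rewrite !big_ord_recr /= IH.
  by field.
rewrite mulr_suml tele lerBlDr lerDl.
by apply: leaky_sum_ge0 => //; rewrite (lt_trans ltr01).
Qed.

Lemma sum_leaky_sum_le (R : realFieldType) (kappa q0 : R) (r : nat -> R) k :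
  1 < kappa -> 0 <= q0 -> (forall m, 0 <= r m) ->
  \sum_(n < k) leaky_sum kappa q0 r n
    <= (kappa * q0 + \sum_(n < k) r n) / (kappa - 1).
Proof.
move=> k1 q00 r0.
have km1 : 0 < kappa - 1 by rewrite subr_gt0.
have le_shift : \sum_(n < k) leaky_sum kappa q0 r n
    <= q0 + \sum_(n < k) leaky_sum kappa q0 r n.+1.
  rewrite -[q0 in q0 + _]/(leaky_sum kappa q0 r 0).
  rewrite -(big_ord_recl k (fun n => leaky_sum kappa q0 r n)) big_ord_recr /=.
  by rewrite lerDl leaky_sum_ge0 // (lt_trans ltr01).
apply: (le_trans le_shift).
apply: (le_trans (lerD (lexx q0) (sum_leaky_sum_succ_le k k1 q00 r0))).
rewrite le_eqVlt; apply/orP; left; apply/eqP; field.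
by rewrite gt_eqF.
Qed.

(** The squares of a contracted sequence are dominated by the same recursion run
on squared inputs, up to a constant mass [M]. The condition [M + N <= kappa * M]
makes [M] a supersolution of the mass recursion in which each step adds the mass
[N] of the input and divides by [kappa]. *)
Lemma sqr_le_mass_leaky_sum (R : realFieldType) (kappa M N q0 : R)
    (a e r : nat -> R) k :
  0 < kappa -> 0 <= M -> 0 <= N -> M + N <= kappa * M ->
  0 <= q0 -> (forall n, 0 <= r n) ->
  (forall n, 0 <= a n) ->
  a 0%N ^+ 2 <= M * q0 ->
  (forall n, (n < k)%N -> e n ^+ 2 <= N * r n) ->
  (forall n, (n < k)%N -> kappa * a n.+1 <= a n + e n) ->
  forall n, (n <= k)%N -> a n ^+ 2 <= M * leaky_sum kappa q0 r n.
Proof.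
move=> k0 M0 N0 MN q00 r0 a0 base er rec; elim=> [//|n IH] ltnk.
have Q0 := leaky_sum_ge0 n k0 q00 r0.
have := sqr_add_le_mass_moment M0 N0 Q0 (r0 n) (IH (ltnW ltnk)) (er _ ltnk).
move=> /= step; rewrite mulrA ler_pdivlMr //.
have sq : (kappa * a n.+1) ^+ 2 <= (a n + e n) ^+ 2.
  have ka : 0 <= kappa * a n.+1 by rewrite mulr_ge0 // ltW.
  by rewrite ler_sqr ?nnegrE ?rec // (le_trans ka) // rec.
rewrite -(ler_pM2l k0).
have -> : kappa * (a n.+1 ^+ 2 * kappa) = (kappa * a n.+1) ^+ 2 by ring.
rewrite mulrA; apply: (le_trans sq); apply: (le_trans step).
by apply: ler_wpM2r MN; rewrite addr_ge0.
Qed.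

(** * Summed squares of real tracking errors *)

(** A bound for the total weight of [a 0], [b 0] and the past steps in the
unrolled error estimate. *)
Definition tracking_rate {R : realFieldType}
    (pi_u pi_w mu_u alpha_u alpha_w kappa : R) : R :=
  (alpha_u * pi_u + alpha_w * pi_w) * (kappa / (kappa - 1))
  + alpha_w * mu_u * pi_u * (kappa / (kappa - 1) ^+ 2).

(** The masses are [Ma] for [a] and [Mb] for [b], and [A], [B] are the recursions
with squared input; [B] is driven by [A], just as [b] is driven by [a]. *)
Lemma sum_sqr_real_tracking_error_le (R : realFieldType)
    (pi_u pi_w mu_u alpha_u alpha_w kappa sigma : R) (a b s : nat -> R) k :
  0 < pi_u -> 0 < pi_w -> 0 <= mu_u -> 0 <= alpha_u -> 0 <= alpha_w ->
  1 < kappa ->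
  (forall n, 0 <= a n) -> (forall n, 0 <= b n) ->
  (forall n, (n < k)%N -> kappa * a n.+1 <= a n + pi_u * s n) ->
  (forall n, (n < k)%N ->
     kappa * b n.+1 <= b n + (mu_u * a n.+1 + pi_w * s n)) ->
  sigma = tracking_rate pi_u pi_w mu_u alpha_u alpha_w kappa ->
  \sum_(n < k) (alpha_u * a n + alpha_w * b n) ^+ 2
    <= a 0%N ^+ 2 * pi_u^-1 * (sigma * alpha_u * kappa / (kappa - 1)
         + sigma * alpha_w * mu_u / (kappa - 1) ^+ 2)
       + b 0%N ^+ 2 * pi_w^-1 * (sigma * alpha_w * kappa / (kappa - 1))
       + sigma ^+ 2 * \sum_(n < k) s n ^+ 2.
Proof.
move=> pu0 pw0 mu0 au0 aw0 k1 a0 b0 reca recb sigma_def.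
have k0 : 0 < kappa by rewrite (lt_trans ltr01).
have c0 : 0 < kappa - 1 by rewrite subr_gt0.
have cn0 : kappa - 1 != 0 by rewrite gt_eqF.
have pun0 : pi_u != 0 by rewrite gt_eqF.
have pwn0 : pi_w != 0 by rewrite gt_eqF.
pose m := kappa / (kappa - 1).
have m0 : 0 <= m by rewrite divr_ge0 // ltW.
have m1 : 1 <= m by rewrite ler_pdivlMr // mul1r gerBl.
(* [Ma] and [Mb] exceed the fixed points of the mass recursions because they also
   have to dominate the initial masses [pi_u] and [pi_w]. *)
pose Ma := pi_u * m.
have Ma0 : 0 <= Ma by rewrite mulr_ge0 // ltW.
pose Mb := pi_w * m + mu_u * Ma / (kappa - 1).
have Mb0 : 0 <= Mb.
  apply: addr_ge0; first by rewrite mulr_ge0 // ltW.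
  by apply: divr_ge0; [rewrite mulr_ge0 | rewrite ltW].
pose A := leaky_sum kappa (a 0%N ^+ 2 / pi_u) (fun n => pi_u * s n ^+ 2).
pose B := leaky_sum kappa (b 0%N ^+ 2 / pi_w)
            (fun n => mu_u * A n.+1 + pi_w * s n ^+ 2).
have qa0 : 0 <= a 0%N ^+ 2 / pi_u by rewrite divr_ge0 ?sqr_ge0 // ltW.
have qb0 : 0 <= b 0%N ^+ 2 / pi_w by rewrite divr_ge0 ?sqr_ge0 // ltW.
have ra0 n : 0 <= pi_u * s n ^+ 2 by rewrite mulr_ge0 ?sqr_ge0 // ltW.
have A0 n : 0 <= A n by apply: leaky_sum_ge0.
have pws0 n : 0 <= pi_w * s n ^+ 2 by rewrite mulr_ge0 ?sqr_ge0 // ltW.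
have rb0 n : 0 <= mu_u * A n.+1 + pi_w * s n ^+ 2.
  by apply: addr_ge0 => //; apply: mulr_ge0.
have B0 n : 0 <= B n by apply: leaky_sum_ge0.
have scale (c y M q : R) : y ^+ 2 <= M * q -> (c * y) ^+ 2 <= c * M * (c * q).
  move=> h; have -> : c * M * (c * q) = c ^+ 2 * (M * q) by ring.
  by rewrite exprMn; apply: ler_wpM2l h; apply: sqr_ge0.
have sqrs n : (pi_u * s n) ^+ 2 <= pi_u * (pi_u * s n ^+ 2).
  by rewrite exprMn expr2 mulrA.
have init (c q : R) : 0 < c -> q ^+ 2 <= c * m * (q ^+ 2 / c).
  move=> cgt; have -> : c * m * (q ^+ 2 / c) = m * q ^+ 2.
    by field; rewrite gt_eqF.
  by rewrite ler_peMl ?sqr_ge0.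
have aA n : (n <= k)%N -> a n ^+ 2 <= Ma * A n.
  apply: (@sqr_le_mass_leaky_sum _ kappa Ma pi_u _ a (fun n => pi_u * s n)) => //.
  - exact: ltW.
  - have -> : kappa * Ma = Ma + pi_u * kappa by rewrite /Ma /m; field.
    by rewrite lerD2l ler_peMr // ltW.
  - exact: init.
have bB n : (n <= k)%N -> b n ^+ 2 <= Mb * B n.
  apply: (@sqr_le_mass_leaky_sum _ kappa Mb (mu_u * Ma + pi_w) _ b
            (fun n => mu_u * a n.+1 + pi_w * s n)) => //.
  - by apply: addr_ge0; [apply: mulr_ge0 | apply: ltW].
  - have -> : kappa * Mb = Mb + (mu_u * Ma + pi_w * kappa).
      by rewrite /Mb /m; field.
    rewrite lerD2l lerD2l ler_peMr //; exact: ltW.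
  - apply: (le_trans (init _ _ pw0)); apply: ler_wpM2r => //.
    by rewrite lerDl; apply: divr_ge0; [apply: mulr_ge0 | apply: ltW].
  - move=> i ltik; apply: sqr_add_le_mass_moment => //.
    + by apply: mulr_ge0.
    + exact: ltW.
    + by apply: mulr_ge0.
    + by apply: scale; apply: aA.
    + by rewrite exprMn expr2 mulrA.
have sigmaE : alpha_u * Ma + alpha_w * Mb = sigma.
  by rewrite sigma_def /tracking_rate /Mb /Ma /m; field.
have err n : (n < k)%N -> (alpha_u * a n + alpha_w * b n) ^+ 2
    <= sigma * (alpha_u * A n + alpha_w * B n).
  move=> /ltnW lenk; rewrite -sigmaE; apply: sqr_add_le_mass_moment => //;
    by [apply: mulr_ge0 | apply: scale; exact: aA | apply: scale; exact: bB].
have sigma0 : 0 <= sigma by rewrite -sigmaE; apply: addr_ge0; apply: mulr_ge0.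
set S := \sum_(n < k) s n ^+ 2.
have S0 : 0 <= S by apply: sumr_ge0 => i _; rewrite sqr_ge0.
have sumA : \sum_(n < k) A n
    <= (kappa * (a 0%N ^+ 2 / pi_u) + pi_u * S) / (kappa - 1).
  by rewrite /S mulr_sumr; apply: sum_leaky_sum_le.
have sumA1 : \sum_(n < k) A n.+1
    <= (a 0%N ^+ 2 / pi_u + pi_u * S) / (kappa - 1).
  by rewrite /S mulr_sumr; apply: sum_leaky_sum_succ_le.
have sumB : \sum_(n < k) B n
    <= (kappa * (b 0%N ^+ 2 / pi_w)
        + (mu_u * ((a 0%N ^+ 2 / pi_u + pi_u * S) / (kappa - 1))
           + pi_w * S)) / (kappa - 1).
  apply: (le_trans (sum_leaky_sum_le k k1 qb0 rb0)).
  rewrite ler_wpM2r ?invr_ge0 ?(ltW c0) // lerD2l big_split /= -!mulr_sumr.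
  by rewrite lerD2r ler_wpM2l.
(* The coefficient of [sigma * S] that telescoping produces; it is smaller than
   [sigma] by a factor [kappa] in each term. *)
pose H := (alpha_u * pi_u + alpha_w * pi_w) / (kappa - 1)
          + alpha_w * mu_u * pi_u / (kappa - 1) ^+ 2.
have H_le : H <= sigma.
  rewrite /H sigma_def /tracking_rate; apply: lerD; apply: ler_wpM2l.
  - by rewrite addr_ge0 // mulr_ge0 // ltW.
  - by rewrite ler_peMl ?invr_ge0 // ltW.
  - by rewrite !mulr_ge0 // ltW.
  - by rewrite ler_peMl ?invr_ge0 ?exprn_ge0 // ltW.
have sum_le : \sum_(n < k) (alpha_u * a n + alpha_w * b n) ^+ 2
    <= sigma * (alpha_u * \sum_(n < k) A n + alpha_w * \sum_(n < k) B n).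
  rewrite !mulr_sumr -big_split /= mulr_sumr; apply: ler_sum => i _.
  exact: err.
apply: (le_trans sum_le).
apply: (@le_trans _ _ (sigma * (alpha_u *
    ((kappa * (a 0%N ^+ 2 / pi_u) + pi_u * S) / (kappa - 1)) + alpha_w *
    ((kappa * (b 0%N ^+ 2 / pi_w)
        + (mu_u * ((a 0%N ^+ 2 / pi_u + pi_u * S) / (kappa - 1))
           + pi_w * S)) / (kappa - 1))))).
  by apply: ler_wpM2l => //; apply: lerD; apply: ler_wpM2l.
(* All terms in [a 0] and [b 0] agree exactly, so only the [S] terms remain. *)
rewrite -subr_ge0; set D := (X in 0 <= X).
have -> : D = sigma * ((sigma - H) * S).
  by rewrite /D /H; field; rewrite cn0 pun0 pwn0.
by apply: mulr_ge0 => //; apply: mulr_ge0; rewrite ?subr_ge0.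
Qed.

(** * Extended distances *)

Lemma fin_num_of_contraction (R : realType) (c : R) (d d' e : \bar R) :
  0 < c -> (0 <= d')%E -> d \is a fin_num -> e \is a fin_num ->
  (c%:E * d' <= d + e)%E -> d' \is a fin_num.
Proof.
move=> c0; case: d' => // _ dfin efin.
rewrite gt0_muley ?lte_fin // leye_eq => /eqP de.
by have := fin_numD d e; rewrite de dfin efin.
Qed.

(** The supremum includes the value at [0]. *)
Lemma dual_norm_diff_ge0 (R : realType) (X U : normedModType R) (p : X -> R)
    (f g : {linear X -> R^o}) : is_seminorm p -> (0 <= dual_norm p (f \- g)%R)%E.
Proof.
move=> psn; apply: ereal_sup_ubound; exists 0 => /=; last first.
  by rewrite !linear0 addr0.
by rewrite -(scale0r (0 : X)) (seminormZ psn) normr0 mul0r.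
Qed.

Lemma sqr_term_EFin_le (R : realType) (c q y : R) (d : \bar R) :
  0 <= c -> 0 < q -> 0 <= y -> (y%:E <= d)%E ->
  ((y ^+ 2 * q^-1 * c)%:E <= d ^+ 2 * (q^-1)%:E * c%:E)%E.
Proof.
move=> c0 q0 y0 yd; rewrite expr2 !EFinM -expe2.
apply: lee_wpmul2r; first by rewrite lee_fin.
apply: lee_wpmul2r; first by rewrite lee_fin invr_ge0 ltW.
by rewrite lee_sqr ?lee_fin // (le_trans _ yd) // lee_fin.
Qed.

(** If [d 0] and [d' 0] are finite, this is the real estimate. An infinite [d 0]
makes [Psi1] infinite, unless both weights vanish and the left-hand side is zero.
An infinite [d' 0] does the same unless [alpha_w = 0]; in that case [b = 0] is an
admissible replacement for [d'], because it satisfies the second recursion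
trivially. *)
Lemma sum_sqr_tracking_error_le (R : realType)
    (pi_u pi_w mu_u alpha_u alpha_w kappa sigma : R) (d d' : nat -> \bar R)
    (s : nat -> R) k :
  0 < pi_u -> 0 < pi_w -> 0 < mu_u -> 0 <= alpha_u -> 0 <= alpha_w ->
  1 < kappa ->
  (forall n, (0 <= d n)%E) -> (forall n, (0 <= d' n)%E) ->
  (forall n, 0 <= s n) ->
  (forall n, (n < k)%N -> (kappa%:E * d n.+1 <= d n + (pi_u * s n)%:E)%E) ->
  (forall n, (n < k)%N ->
     (kappa%:E * d' n.+1 <= d' n + mu_u%:E * d n.+1 + (pi_w * s n)%:E)%E) ->
  sigma = tracking_rate pi_u pi_w mu_u alpha_u alpha_w kappa ->
  (\sum_(n < k) (alpha_u%:E * d n + alpha_w%:E * d' n) ^+ 2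
     <= Psi1 pi_u pi_w mu_u alpha_u alpha_w kappa sigma (d 0%N) (d' 0%N)
        + (sigma ^+ 2 * \sum_(n < k) s n ^+ 2)%:E)%E.
Proof.
move=> pu0 pw0 mu0 au0 aw0 k1 d_ge0 d'_ge0 s_ge0 recd recd' sigma_def.
have k0 : 0 < kappa by rewrite (lt_trans ltr01).
have c0 : 0 < kappa - 1 by rewrite subr_gt0.
have rate_u0 : 0 < kappa / (kappa - 1) by rewrite divr_gt0.
have sigma_ge : (alpha_u * pi_u + alpha_w * pi_w) * (kappa / (kappa - 1))
    <= sigma.
  by rewrite sigma_def /tracking_rate lerDl !mulr_ge0 ?invr_ge0 ?exprn_ge0 // ltW.
have sigma0 : 0 <= sigma.
  by apply: le_trans sigma_ge; rewrite !(mulr_ge0, addr_ge0) // ltW ?invr_gt0.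
set Cu := sigma * alpha_u * kappa / (kappa - 1)
          + sigma * alpha_w * mu_u / (kappa - 1) ^+ 2.
set Cw := sigma * alpha_w * kappa / (kappa - 1).
have Cu1 : 0 <= sigma * alpha_u * kappa / (kappa - 1).
  by rewrite !mulr_ge0 ?invr_ge0 // ltW.
have Cu2 : 0 <= sigma * alpha_w * mu_u / (kappa - 1) ^+ 2.
  by rewrite !mulr_ge0 ?invr_ge0 ?exprn_ge0 // ltW.
have Cu0 : 0 <= Cu by exact: addr_ge0.
have Cw0 : 0 <= Cw by rewrite !mulr_ge0 ?invr_ge0 // ltW.
have S0 : 0 <= sigma ^+ 2 * \sum_(n < k) s n ^+ 2.
  by rewrite mulr_ge0 ?sqr_ge0 // sumr_ge0 // => i _; rewrite sqr_ge0.
have Tu0 : (0 <= d 0%N ^+ 2 * (pi_u^-1)%:E * Cu%:E)%E.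
  by rewrite !mule_ge0 ?sqre_ge0 ?lee_fin ?invr_ge0 // ltW.
have Tw0 : (0 <= d' 0%N ^+ 2 * (pi_w^-1)%:E * Cw%:E)%E.
  by rewrite !mule_ge0 ?sqre_ge0 ?lee_fin ?invr_ge0 // ltW.
have T_top (q C : R) : 0 < q -> 0 < C ->
    ((+oo : \bar R) ^+ 2 * (q^-1)%:E * C%:E = +oo)%E.
  by move=> q0 C0; rewrite expe2 mulyy !gt0_mulye ?lte_fin ?invr_gt0.
have bound (a b : nat -> R) :
    (forall n, 0 <= a n) -> (forall n, 0 <= b n) ->
    ((a 0%N)%:E <= d 0%N)%E -> ((b 0%N)%:E <= d' 0%N)%E ->
    (forall n, (n < k)%N -> kappa * a n.+1 <= a n + pi_u * s n) ->
    (forall n, (n < k)%N ->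
       kappa * b n.+1 <= b n + (mu_u * a n.+1 + pi_w * s n)) ->
    (forall n, (n < k)%N -> alpha_u%:E * d n + alpha_w%:E * d' n
       = (alpha_u * a n + alpha_w * b n)%:E)%E ->
    (\sum_(n < k) (alpha_u%:E * d n + alpha_w%:E * d' n) ^+ 2
     <= Psi1 pi_u pi_w mu_u alpha_u alpha_w kappa sigma (d 0%N) (d' 0%N)
        + (sigma ^+ 2 * \sum_(n < k) s n ^+ 2)%:E)%E.
  move=> a_ge0 b_ge0 ad bd reca recb errE.
  have -> : (\sum_(n < k) (alpha_u%:E * d n + alpha_w%:E * d' n) ^+ 2
      = (\sum_(n < k) (alpha_u * a n + alpha_w * b n) ^+ 2)%:E)%E.
    rewrite -sumEFin; apply: eq_bigr => i _.
    by rewrite errE // EFin_expe.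
  have real_bound := sum_sqr_real_tracking_error_le pu0 pw0 (ltW mu0) au0 aw0
    k1 a_ge0 b_ge0 reca recb sigma_def.
  rewrite -lee_fin in real_bound; apply: (le_trans real_bound).
  rewrite EFinD; apply: leeD => //; rewrite EFinD.
  by apply: leeD; apply: sqr_term_EFin_le.
have [/andP[/eqP alu /eqP alw]|] := boolP ((alpha_u == 0) && (alpha_w == 0)).
  rewrite big1 ?adde_ge0 // => i _.
  by rewrite alu alw !mul0e adde0 expe2 mule0.
rewrite negb_and => /orP alpha_pos.
have sigma_gt0 : 0 < sigma.
  apply: lt_le_trans sigma_ge; apply: mulr_gt0 => //.
  have [wu0 ww0] : 0 <= alpha_u * pi_u /\ 0 <= alpha_w * pi_w.
    by split; rewrite mulr_ge0 // ltW.
  case: alpha_pos => al.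
    by apply: ltr_wpDr => //; rewrite mulr_gt0 // lt0r al.
  by apply: ltr_wpDl => //; rewrite mulr_gt0 // lt0r al.
have [d0fin|] := boolP (d 0%N \is a fin_num); last first.
  rewrite ge0_fin_numE // -leNgt leye_eq => /eqP d0oo.
  suff Cu_gt0 : 0 < Cu.
    by rewrite /Psi1 d0oo T_top // addye ?addye ?leey // gt_eqF // (lt_le_trans _ Tw0).
  case: alpha_pos => al.
    by apply: ltr_wpDr => //; rewrite !mulr_gt0 ?invr_gt0 // lt0r al.
  by apply: ltr_wpDl => //; rewrite !mulr_gt0 ?invr_gt0 ?exprn_gt0 // lt0r al.
have dfin n : (n <= k)%N -> d n \is a fin_num.
  elim: n => // n IH ltnk.
  exact: fin_num_of_contraction k0 (d_ge0 _) (IH (ltnW ltnk)) _ (recd _ ltnk).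
pose a n := fine (d n).
have aE n : (n <= k)%N -> d n = (a n)%:E by move=> lenk; rewrite fineK // dfin.
have a_ge0 n : 0 <= a n by rewrite fine_ge0.
have reca n : (n < k)%N -> kappa * a n.+1 <= a n + pi_u * s n.
  by move=> ltnk; have := recd n ltnk; rewrite !aE ?lee_fin // ltnW.
have [alw|alw] := eqVneq alpha_w 0.
  apply: (bound a (fun _ => 0)) => // [|n ltnk|n ltnk].
  - by rewrite aE.
  - by rewrite mulr0 add0r addr_ge0 // mulr_ge0 // ltW.
  - by rewrite alw (aE n (ltnW ltnk)) mul0e adde0 mul0r addr0.
have alw_gt0 : 0 < alpha_w by rewrite lt0r alw.
have [d'0fin|] := boolP (d' 0%N \is a fin_num); last first.
  rewrite ge0_fin_numE // -leNgt leye_eq => /eqP d'0oo.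
  have Cw_gt0 : 0 < Cw by rewrite !mulr_gt0 ?invr_gt0.
  by rewrite /Psi1 d'0oo T_top // addey ?addye ?leey // gt_eqF // (lt_le_trans _ Tu0).
have d'fin n : (n <= k)%N -> d' n \is a fin_num.
  elim: n => // n IH ltnk.
  have := recd' _ ltnk; rewrite -addeA.
  apply: fin_num_of_contraction k0 (d'_ge0 _) (IH (ltnW ltnk)) _.
  by rewrite aE.
pose b n := fine (d' n).
have bE n : (n <= k)%N -> d' n = (b n)%:E by move=> lenk; rewrite fineK // d'fin.
apply: (bound a b) => // [n|||n ltnk|n ltnk].
- by rewrite fine_ge0.
- by rewrite aE.
- by rewrite bE.
- by have := recd' n ltnk; rewrite !(aE, bE) ?(ltnW ltnk) // -addeA lee_fin.
- by rewrite aE ?bE // ltnW.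
Qed.

(** * The differential error along the iteration *)

Unset Implicit Arguments.
Set Strict Implicit.

Theorem theorem3p8 (R : realType) (X U : normedModType R) (W : Type)
    (p : X -> R) (p_seminorm : is_seminorm p)
    (dU : U -> U -> \bar R) (dU_ge0 : forall a b, (0 <= dU a b)%E)
    (dW : W -> W -> \bar R) (dW_ge0 : forall a b, (0 <= dW a b)%E)
    (J : U -> R^o) (J_diff : forall v, differentiable J v)
    (Su : X -> U) (Su_diff : forall z, differentiable Su z)
    (Sw : X -> W) (OmegaX : set X)
    (x : nat -> X) (u : nat -> U) (w : nat -> W)
    (Ft : nat -> {linear X -> R^o}) (Ft_cont : forall n, continuous (Ft n))
    (pi_u pi_w mu_u kappa_u kappa_w alpha_u alpha_w : R)
    (pi_u_gt0 : 0 < pi_u) (pi_w_gt0 : 0 < pi_w) (mu_u_gt0 : 0 < mu_u)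
    (kappa_u_gt1 : 1 < kappa_u) (kappa_w_gt1 : 1 < kappa_w)
    (alpha_u_ge0 : 0 <= alpha_u) (alpha_w_ge0 : 0 <= alpha_w)
    (k : nat)
    (track : forall n, (n <= k)%N ->
       tracking_assumption OmegaX p dU dW J Su Sw
         pi_u pi_w mu_u kappa_u kappa_w alpha_u alpha_w x u w Ft n)
    (x_in : forall n, (n <= k)%N -> OmegaX (x n)) :
  let kappa := Num.min kappa_u kappa_w in
  let kappabar := Num.max kappa_u kappa_w in
  let err := tracking_error dU dW Su Sw alpha_u alpha_w x u w in
  exists (sigma1 : R) (elip : nat -> \bar R),
    [/\ 0 <= sigma1,
        sigma1 <= (alpha_u * pi_u + alpha_w * pi_w) * kappa * kappabar
                    / (kappa - 1)
                  + alpha_w * mu_u * pi_u * kappabar / (kappa - 1) ^+ 2,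
        forall n, (n <= k)%N ->
          [/\ (0 <= elip n)%E,
              (dual_norm p (Ft n \- 'd (J \o Su) (x n))%R ^+ 2 <= err n ^+ 2)%E,
              (err n ^+ 2 <= elip n)%E
            & err n \is a fin_num -> elip n \is a fin_num]
      & (\sum_(n < k) elip n <=
           Psi1 pi_u pi_w mu_u alpha_u alpha_w kappa sigma1
                (dU (u 1%N) (Su (x 0%N))) (dW (w 1%N) (Sw (x 0%N)))
           + (sigma1 ^+ 2 * \sum_(n < k) p (x n.+1 - x n) ^+ 2)%:E)%E].
Proof.
move=> kappa kappabar err.
have bnd n : (n <= k)%N -> tracking_bounds p dU dW J Su Sw
    pi_u pi_w mu_u kappa_u kappa_w alpha_u alpha_w x u w Ft n.
  by move=> lenk; apply: track => // j lejn; apply: x_in; apply: leq_trans lenk.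
have k1 : 1 < kappa by rewrite lt_min kappa_u_gt1.
have kle : kappa <= kappabar by rewrite ge_min le_max lexx.
have c0 : 0 < kappa - 1 by rewrite subr_gt0.
have k0 : 0 < kappa by rewrite (lt_trans ltr01).
(* [sigma] has a factor [kappa] where the stated bound has [kappa * kappabar] or
   [kappabar], both of which are at least [kappa]. *)
pose sigma := tracking_rate pi_u pi_w mu_u alpha_u alpha_w kappa.
have Au0 : 0 <= alpha_u * pi_u + alpha_w * pi_w.
  by rewrite addr_ge0 ?mulr_ge0 // ltW.
have Bu0 : 0 <= alpha_w * mu_u * pi_u by rewrite !mulr_ge0 // ltW.
have err_ge0 n : (0 <= err n)%E by rewrite adde_ge0 ?mule_ge0.
exists sigma, (fun n => (err n ^+ 2)%E); split.
- rewrite /sigma /tracking_rate addr_ge0 // mulr_ge0 //.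
    by rewrite divr_ge0 // ltW.
  by rewrite divr_ge0 ?exprn_ge0 // ltW.
- rewrite /sigma /tracking_rate; apply: lerD.
    rewrite -[leRHS]mulrA -[leRHS]mulrA; apply: ler_wpM2l => //.
    apply: ler_wpM2l; first exact: ltW.
    by rewrite ler_peMl ?invr_ge0 ?ltW // (lt_le_trans k1).
  rewrite -[leRHS]mulrA; apply: ler_wpM2l => //.
  by rewrite ler_wpM2r // invr_ge0 exprn_ge0 // ltW.
- move=> n lenk; split=> //.
  + exact: sqre_ge0.
  + rewrite lee_sqr ?dual_norm_diff_ge0 //.
    exact: tracking_differential (bnd n lenk).
  + exact: fin_numX.
- apply: (sum_sqr_tracking_error_le (d := fun n => dU (u n.+1) (Su (x n)))
    (d' := fun n => dW (w n.+1) (Sw (x n)))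
    (s := fun n => p (x n.+1 - x n))) => //.
  + by move=> n; exact: (seminorm_ge0 p_seminorm).
  + move=> n ltnk; apply: le_trans (tracking_inner (bnd n.+1 ltnk) isT).
    by apply: lee_wpmul2r => //; rewrite lee_fin ge_min lexx.
  + move=> n ltnk; apply: le_trans (tracking_adjoint (bnd n.+1 ltnk) isT).
    by apply: lee_wpmul2r => //; rewrite lee_fin ge_min lexx orbT.
Qed.
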